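(* Let $p : X \to Y$ be a flat morphism of relative dimension $1$, where $X$ and $Y$ are smooth projective varieties with $\dim X = n$, and suppose that $p$ admits a section, whose image (and its class in $A^1(X)$) is denoted by $\Theta$. Suppose that $$\Theta^2 = h\,\Theta\, p^\ast H$$ for some divisor $H \in A^1(Y)$ and some $h \in \mathbb{R}$, and that $\omega$ is a divisor on $X$ of the form $$\omega = u\Theta + v\,p^\ast H$$ for some $u, v \in \mathbb{R}$. Then for any $r \in \mathbb{R}$ with $r \neq 0$, the condition $$\omega^2\,(p^\ast \eta) = r\,(\Theta\, p^\ast H)\,(p^\ast \eta) \quad \text{for all } \eta \in A^{n-2}(Y)$$ has a 1-parameter family of solutions in $u, v$ where $u$ can be written as a formal power series in $\frac{1}{2v}$: $$u = \sum_{i=0}^\infty c_i\, r^{i+1} (-h)^i \left(\frac{1}{2v}\right)^{2i+1},$$ where $c_i$ is the $i$-th Catalan number. Moreover, when $h \neq 0$, as a power series in the variable $\frac{1}{2v}$, the power series $\sum_{i=0}^\infty c_i\, r^{i+1} (-h)^i \left(\frac{1}{2v}\right)^{2i+1}$ has radius of convergence $\frac{1}{2\sqrt{|rh|}}$.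
   Context: For a smooth projective variety $X$ of dimension $n$, $A^\ast(X) = \bigoplus_{i=0}^n A^i(X)$ denotes its Chow ring with coefficients in $\mathbb{R}$, a graded commutative ring in which each $A^i(X)$ is an $\mathbb{R}$-vector space and $A^i(X) = 0$ for $i \notin [0,n]$; products of classes are taken in this ring. The paper's convention is that $A^n(X)$ is a 1-dimensional real vector space spanned by the class of a point, and is identified with $\mathbb{R}$ via this basis. Likewise $A^0(X)$ is spanned by the fundamental class $[X]$, which is the multiplicative identity, and is identified with $\mathbb{R}$. A divisor on $X$ means an element of $A^1(X)$. Since $p$ has relative dimension $1$, $\dim Y = n-1$. The map $p^\ast : A^\ast(Y) \to A^\ast(X)$ is the pullback, a homomorphism of graded rings. The Catalan numbers $\{c_n\}_{n\ge 0} = 1,1,2,5,14,42,\dots$ are defined by $c_0 = 1$ and $c_n = \sum_{i+j=n-1} c_i c_j$ for $n \geq 1$. That $u$ is given by a formal power series in $\frac{1}{2v}$ is understood with $\frac{1}{2v}$ treated as a formal variable: substituting this series for $u$ makes the displayed condition on $\omega = u\Theta + v\,p^\ast H$ hold formally. *)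

(* Defs.v *)
From HB Require Import structures.
From mathcomp Require Import all_boot all_order all_algebra.
From mathcomp Require Import all_classical all_reals all_analysis.

Set Implicit Arguments.
Unset Strict Implicit.
Unset Printing Implicit Defensive.

Import Order.TTheory GRing.Theory Num.Theory.
Import numFieldNormedType.Exports.

Local Open Scope classical_set_scope.
Local Open Scope ring_scope.

(** * Chow rings *)

(* The Chow ring with coefficients in R of an n-dimensional variety, as a
   commutative R-algebra that is the internal direct sum of subspaces A^i.
   The index i is an integer, so that A^i makes sense (and is 0) outside of
   [0, n].  Both A^0 and A^n are lines, spanned by the fundamental class 1 and
   by the class of a point respectively. *)
Record chow_ring (R : realType) (n : nat) := ChowRing {
  chow_carrier :> comAlgType R ;
  chow_gr : int -> set chow_carrier ;
  chow_gr0 : forall i, chow_gr i 0 ;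
  chow_grD : forall i (a : R) (x y : chow_carrier),
    chow_gr i x -> chow_gr i y -> chow_gr i (a *: x + y) ;
  chow_gr_out : forall (i : int) (x : chow_carrier),
    ~~ (0 <= i <= n%:Z) -> chow_gr i x -> x = 0 ;
  chow_grM : forall (i j : int) (x y : chow_carrier),
    chow_gr i x -> chow_gr j y -> chow_gr (i + j) (x * y) ;
  chow_gr_sum : forall x : chow_carrier, exists f : nat -> chow_carrier,
    (forall i : nat, chow_gr i%:Z (f i)) /\ x = \sum_(i < n.+1) f i ;
  chow_gr_direct : forall f : nat -> chow_carrier,
    (forall i : nat, chow_gr i%:Z (f i)) -> \sum_(i < n.+1) f i = 0 ->
    forall i : nat, (i <= n)%N -> f i = 0 ;
  chow_gr_unit : forall x : chow_carrier,
    chow_gr 0 x <-> exists a : R, x = a%:A ;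
  chow_point : chow_carrier ;
  chow_point_neq0 : chow_point <> 0 ;
  chow_gr_top : forall x : chow_carrier,
    chow_gr n%:Z x <-> exists a : R, x = a *: chow_point
}.

(* The standard formalism of Chow rings (with real coefficients) on the category
   of smooth projective varieties over a field and their morphisms: contravariant
   functoriality for graded ring homomorphisms f^*, covariant functoriality for
   proper pushforward f_*, and the projection formula.  Varieties and morphisms
   are abstract here; flat f d reads "f is flat of relative dimension d". *)
Record chow_theory (R : realType) := ChowTheory {
  variety : Type ;
  vdim : variety -> nat ;
  vmor : variety -> variety -> Type ;
  idvmor : forall X, vmor X X ;
  vcomp : forall X Y Z, vmor Y Z -> vmor X Y -> vmor X Z ;
  vcompA : forall X Y Z W (f : vmor Z W) (g : vmor Y Z) (e : vmor X Y),
    vcomp f (vcomp g e) = vcomp (vcomp f g) e ;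
  vcomp1m : forall X Y (f : vmor X Y), vcomp (idvmor Y) f = f ;
  vcompm1 : forall X Y (f : vmor X Y), vcomp f (idvmor X) = f ;
  flat : forall X Y, vmor X Y -> nat -> Prop ;
  flat_dim : forall X Y (f : vmor X Y) d, flat f d -> vdim X = (vdim Y + d)%N ;
  chow : forall X, chow_ring R (vdim X) ;
  pull : forall X Y, vmor X Y -> {lrmorphism chow Y -> chow X} ;
  pull_gr : forall X Y (f : vmor X Y) (i : int) (y : chow Y),
    chow_gr i y -> chow_gr i (pull f y) ;
  pull_id : forall X (x : chow X), pull (idvmor X) x = x ;
  pull_comp : forall X Y Z (f : vmor Y Z) (g : vmor X Y) (z : chow Z),
    pull (vcomp f g) z = pull g (pull f z) ;
  push : forall X Y, vmor X Y -> {linear chow X -> chow Y} ;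
  (* pushforward preserves the dimension of cycles *)
  push_gr : forall X Y (f : vmor X Y) (i : int) (x : chow X),
    chow_gr i x -> chow_gr (i + (vdim Y)%:Z - (vdim X)%:Z) (push f x) ;
  push_id : forall X (x : chow X), push (idvmor X) x = x ;
  push_comp : forall X Y Z (f : vmor Y Z) (g : vmor X Y) (x : chow X),
    push (vcomp f g) x = push f (push g x) ;
  push_pull : forall X Y (f : vmor X Y) (x : chow X) (y : chow Y),
    push f (x * pull f y) = push f x * y
}.

Arguments idvmor {R c} X.

Definition is_section (R : realType) (C : chow_theory R) (X Y : variety C)
  (p : vmor X Y) (s : vmor Y X) : Prop := vcomp p s = idvmor Y.

(* A section s of p is a closed immersion, so [s(Y)] = s_*[Y]. *)
Definition section_class (R : realType) (C : chow_theory R) (X Y : variety C)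
  (s : vmor Y X) : chow X := push s 1.

(** * Formal Laurent series *)

(* A((t)) : the series \sum_k f_k t^k, over integers k, with f_k = 0 for k
   sufficiently negative. *)
Record laurent (A : zmodType) := Laurent {
  lcoef :> int -> A ;
  lcoef_bound : exists N : int, forall k : int, k < N -> lcoef k = 0
}.

Lemma laurentP (A : zmodType) (f g : laurent A) : lcoef f =1 lcoef g -> f = g.
Proof.
case: f g => [f Hf] [g Hg] /= /funext fg; rewrite -{}fg in Hg *.
by congr Laurent; exact: Prop_irrelevance.
Qed.

Lemma lmono_bound (A : zmodType) (n : int) (a : A) :
  exists N : int, forall k : int, k < N -> (if k == n then a else 0) = 0.
Proof. by exists n => k; case: eqP => // ->; rewrite ltxx. Qed.

(* a t^n *)
Definition lmono (A : zmodType) (n : int) (a : A) : laurent A :=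
  Laurent (lmono_bound n a).

Definition lconst (A : zmodType) (a : A) : laurent A := lmono 0 a.

Lemma ladd_bound (A : zmodType) (f g : laurent A) :
  exists N : int, forall k : int, k < N -> f k + g k = 0.
Proof.
have [[M fM] [N gN]] := (lcoef_bound f, lcoef_bound g).
by exists (Num.min M N) => k; rewrite lt_min => /andP[? ?]; rewrite fM// gN// addr0.
Qed.

Definition ladd (A : zmodType) (f g : laurent A) : laurent A :=
  Laurent (ladd_bound f g).

Lemma lmul_bound (A : pzRingType) (f g : laurent A) :
  exists N : int, forall k : int, k < N ->
    \sum_(i \in [set: int]) f i * g (k - i) = 0.
Proof.
have [[M fM] [N gN]] := (lcoef_bound f, lcoef_bound g).
exists (M + N) => k kMN; apply: fsbig1 => i _.
have [iM|Mi] := ltP i M; first by rewrite fM// mul0r.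
by rewrite gN ?mulr0// ltrBlDr (lt_le_trans kMN)// addrC lerD2l.
Qed.

(* Only finitely many terms of the sum defining each coefficient are nonzero,
   so that the finite-support sum is the full Cauchy product. *)
Definition lmul (A : pzRingType) (f g : laurent A) : laurent A :=
  Laurent (lmul_bound f g).

Lemma lmulMono (A : pzRingType) (m n : int) (a b : A) :
  lmul (lmono m a) (lmono n b) = lmono (m + n) (a * b).
Proof.
apply: laurentP => k /=.
rewrite -(@fsbig_widen _ _ 0 +%R [set m])//=.
  rewrite fsbig_set1 eqxx (_ : (k - m == n) = (k == m + n)).
    by case: ifP; rewrite ?mulr0.
  by rewrite subr_eq addrC.
by move=> i /= [_ /eqP/negbTE ->]; rewrite mul0r.
Qed.

Lemma lscale_bound (R : pzRingType) (V : lmodType R) (f : laurent R) (x : V) :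
  exists N : int, forall k : int, k < N -> f k *: x = 0.
Proof.
by have [N fN] := lcoef_bound f; exists N => k /fN ->; rewrite scale0r.
Qed.

(* The image of f (x) x under R((t)) (x) V -> V((t)). *)
Definition lscale (R : pzRingType) (V : lmodType R) (f : laurent R) (x : V) :
  laurent V := Laurent (lscale_bound f x).

Lemma lseries_bound (A : zmodType) (a : nat -> A) :
  exists N : int, forall k : int, k < N ->
    (if k is Posz i then a i else 0) = 0.
Proof. by exists 0 => -[]. Qed.

(* The inclusion A[[t]] -> A((t)). *)
Definition lseries (A : zmodType) (a : nat -> A) : laurent A :=
  Laurent (lseries_bound a).

(* v such that t = 1/(2v). *)
Definition half_inv_var (R : realType) : laurent R := lmono (-1) 2^-1.

Lemma half_inv_varP (R : realType) :
  lmul (lmul (lconst 2) (half_inv_var R)) (lmono 1 1) = lconst 1.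
Proof.
by rewrite /lconst /half_inv_var !lmulMono add0r addNr mulr1 mulfV// pnatr_eq0.
Qed.

(** * Catalan numbers and power series *)

Fixpoint catalan_seq (n : nat) : seq nat :=
  if n is m.+1 then
    let s := catalan_seq m in
    rcons s (\sum_(i < m.+1) nth 0%N s i * nth 0%N s (m - i))%N
  else [:: 1%N].

Definition catalan (n : nat) : nat := nth 0%N (catalan_seq n) n.

Lemma size_catalan_seq n : size (catalan_seq n) = n.+1.
Proof. by elim: n => //= n IHn; rewrite size_rcons IHn. Qed.

Lemma nth_catalan_seq n i : (i <= n)%N -> nth 0%N (catalan_seq n) i = catalan i.
Proof.
elim: n => [|n IHn]; first by rewrite leqn0 => /eqP ->.
rewrite leq_eqVlt => /predU1P[-> //|]; rewrite ltnS => le_in /=.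
by rewrite nth_rcons size_catalan_seq ltnS le_in IHn.
Qed.

Lemma catalan0 : catalan 0 = 1%N.
Proof. by []. Qed.

Lemma catalanS n :
  catalan n.+1 = (\sum_(i < n.+1) catalan i * catalan (n - i))%N.
Proof.
rewrite {1}/catalan /= nth_rcons size_catalan_seq ltnn eqxx.
by apply: eq_bigr => i _; rewrite !nth_catalan_seq ?leq_subr// -ltnS.
Qed.

(* Coefficients of \sum_i c_i r^(i+1) (-h)^i t^(2i+1) as a series in t. *)
Definition catalan_coef (R : realType) (r h : R) (k : nat) : R :=
  if odd k then (catalan k./2)%:R * r ^+ (k./2).+1 * (- h) ^+ k./2 else 0.

Definition convergence_radius (R : realType) (a : nat -> R) : \bar R :=
  ereal_sup [set (`|x|)%:E | x in [set x : R | cvgn (pseries a x)]].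

(* Main.v *)
Require Import Defs.
From HB Require Import structures.
From mathcomp Require Import all_boot all_order all_algebra.
From mathcomp Require Import all_classical all_reals all_analysis.
From mathcomp Require Import zify ring lra.

(** With t = 1/(2v), so that v = 1/(2t), expand omega^2 p^*eta for omega = u
    Theta + v p^*H. By the relation Theta^2 = h Theta p^*H, the terms
    containing Theta add up to (h u^2 + 2 v u) (Theta p^*H) p^*eta, while
    the remaining one is v^2 p^*(H^2 eta). As H^2 eta has degree n on Y,
    whose dimension is n - 1, it vanishes. It is thus enough that u be a
    root of the quadratic equation h u^2 + 2 v u = r, that is, of u = r t -
    h t u^2 ([catalan_series_eq]): comparing coefficients, this is the
    Catalan recurrence.

    For the radius of convergence, the partial sums of the absolute values
    of the series at t = y are, up to the factor |r y|, the partial sums S_N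
    of the Catalan series \sum_i c_i z^i at z = |r h| y^2
    ([norm_catalan_series]), so it has to be shown that the S_N are bounded
    exactly when z <= 1/4. The Catalan recurrence gives 1 + z S_N^2 as an
    upper bound of S_(N+1) and as a lower bound of S_(2N+1). If z <= 1/4,
    the map s |-> 1 + z s^2 preserves the interval [0, 2], so that S_N <= 2
    ([catalan_sum_le2]). If z > 1/4, this map has no real fixed point and
    increases s by an amount bounded below, so that S_N tends to infinity
    ([catalan_sum_unbounded]). *)

Set Implicit Arguments.
Unset Strict Implicit.
Unset Printing Implicit Defensive.

Import Order.TTheory GRing.Theory Num.Theory.
Import numFieldNormedType.Exports.

Local Open Scope ring_scope.

(** * Products of Laurent series *)

(** As f and g vanish below M and N, a term f_i g_(k-i) is nonzero only for
    i in [M, k - N].  Leaving the length d of the window free allows products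
    with different factors to be summed over the same window. *)
Lemma lmul_coef (A : pzRingType) (f g : laurent A) (M N k : int) (d : nat) :
  (forall i, i < M -> f i = 0) -> (forall i, i < N -> g i = 0) ->
  k - M - N < d%:Z ->
  lmul f g k = \sum_(i < d) f (M + i%:Z) * g (k - (M + i%:Z)).
Proof.
move=> fM gN kd.
rewrite (fsbig_ord +%R d (fun i => f (M + i%:Z) * g (k - (M + i%:Z)))) /=.
have inj : set_inj `I_d (fun i : nat => M + i%:Z) by move=> i j _ _; lia.
rewrite -(fsbig_image _ _ (fun i => f i * g (k - i)) inj).
apply/esym/fsbig_widen => // i /= [_ iNd].
have [iM|Mi] := ltP i M; first by rewrite fM ?mul0r.
have [ki|ki] := ltP (k - i) N; first by rewrite gN ?mulr0.
by case: iNd; exists (absz (i - M)); lia.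
Qed.

Lemma lmulDl (A : pzRingType) (f g e : laurent A) :
  lmul (ladd f g) e = ladd (lmul f e) (lmul g e).
Proof.
apply: laurentP => k.
have [[[M1 fM] [M2 gM]] [N eN]] :=
  (lcoef_bound f, lcoef_bound g, lcoef_bound e).
pose M := Num.min M1 M2; pose d := (absz (k - M - N)%R).+1.
have fM' i : i < M -> f i = 0 by rewrite lt_min => /andP[/fM].
have gM' i : i < M -> g i = 0 by rewrite lt_min => /andP[_ /gM].
have fgM i : i < M -> ladd f g i = 0.
  by move=> iM; rewrite /= fM' ?gM' ?addr0.
have kd : k - M - N < d%:Z by rewrite /d; lia.
rewrite [RHS]/(lmul f e k + lmul g e k) (lmul_coef fgM eN kd).
rewrite (lmul_coef fM' eN kd) (lmul_coef gM' eN kd).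
apply: etrans (big_split _ _ _ _ _).
by apply: eq_bigr => i _; rewrite mulrDl.
Qed.

Lemma lmulDr (A : pzRingType) (e f g : laurent A) :
  lmul e (ladd f g) = ladd (lmul e f) (lmul e g).
Proof.
apply: laurentP => k.
have [[[N1 fN] [N2 gN]] [M eM]] :=
  (lcoef_bound f, lcoef_bound g, lcoef_bound e).
pose N := Num.min N1 N2; pose d := (absz (k - M - N)%R).+1.
have fN' i : i < N -> f i = 0 by rewrite lt_min => /andP[/fN].
have gN' i : i < N -> g i = 0 by rewrite lt_min => /andP[_ /gN].
have fgN i : i < N -> ladd f g i = 0.
  by move=> iN; rewrite /= fN' ?gN' ?addr0.
have kd : k - M - N < d%:Z by rewrite /d; lia.
rewrite [RHS]/(lmul e f k + lmul e g k) (lmul_coef eM fgN kd).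
rewrite (lmul_coef eM fN' kd) (lmul_coef eM gN' kd).
apply: etrans (big_split _ _ _ _ _).
by apply: eq_bigr => i _; rewrite mulrDr.
Qed.

(** The map R((t)) (x) A -> A((t)) is multiplicative, since scalars are
    central in A; this reduces the square of omega to products of the scalar
    series u and v. *)
Lemma lmul_lscale (R : comPzRingType) (A : algType R) (f g : laurent R)
    (x y : A) :
  lmul (lscale f x) (lscale g y) = lscale (lmul f g) (x * y).
Proof.
apply: laurentP => k.
have [[M fM] [N gN]] := (lcoef_bound f, lcoef_bound g).
have kd : k - M - N < (absz (k - M - N)%R).+1%:Z by lia.
have fxM i : i < M -> lscale f x i = 0 by move=> /fM /= ->; rewrite scale0r.
have gyN i : i < N -> lscale g y i = 0 by move=> /gN /= ->; rewrite scale0r.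
rewrite [RHS]/(lmul f g k *: (x * y)) (lmul_coef fM gN kd).
rewrite (lmul_coef fxM gyN kd).
apply: etrans (esym (scaler_suml _ _ _ _)).
by apply: eq_bigr => i _; rewrite /= -scalerAl -scalerAr scalerA.
Qed.

Lemma lmul_lmonol (A : pzRingType) (m : int) (a : A) (f : laurent A) k :
  lmul (lmono m a) f k = a * f (k - m).
Proof.
rewrite /= -(@fsbig_widen _ _ 0 +%R [set m]%classic) //=.
  by rewrite fsbig_set1 eqxx.
by move=> i /= [_ /eqP/negbTE ->]; rewrite mul0r.
Qed.

Lemma lmul_lmonor (A : pzRingType) (m : int) (a : A) (f : laurent A) k :
  lmul f (lmono m a) k = f (k - m) * a.
Proof.
rewrite /= -(@fsbig_widen _ _ 0 +%R [set k - m]%classic) //=.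
  by rewrite fsbig_set1 opprB addrCA subrr addr0 eqxx.
move=> i /= [_ ikm]; case: eqP => [kim|_]; last by rewrite mulr0.
by case: ikm; lia.
Qed.

Lemma lmul_lseries (A : pzRingType) (a b : nat -> A) :
  lmul (lseries a) (lseries b) =
  lseries (fun n => \sum_(i < n.+1) a i * b (n - i)%N).
Proof.
have neg (c : nat -> A) i : i < 0 -> lseries c i = 0 by case: i.
apply: laurentP => -[n|n].
  have kd : n%:Z - 0 - 0 < n.+1%:Z by lia.
  rewrite (lmul_coef (neg a) (neg b) kd); apply: eq_bigr => i _.
  by rewrite add0r subzn // -ltnS.
have kd : Negz n - 0 - 0 < 0%:Z by lia.
by rewrite (lmul_coef (neg a) (neg b) kd) big_ord0.
Qed.

(** * The quadratic equation for the Catalan series *)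

Lemma sum_even_odd (V : nmodType) (F : nat -> V) n :
  \sum_(i < n.*2) F i = \sum_(i < n) (F i.*2 + F i.*2.+1).
Proof.
elim: n => [|n IHn]; first by rewrite !big_ord0.
by rewrite doubleS !big_ord_recr /= IHn addrA.
Qed.

Section CatalanSeries.
Variables (R : realType) (r h : R).
Local Notation a := (catalan_coef r h).

Lemma catalan_coef_even k : a k.*2 = 0.
Proof. by rewrite /catalan_coef odd_double. Qed.

Lemma catalan_coef_odd k :
  a k.*2.+1 = (catalan k)%:R * r ^+ k.+1 * (- h) ^+ k.
Proof. by rewrite /catalan_coef /= odd_double /= uphalf_double. Qed.

(** In even degree m = 2 (j + 1) this is the recurrence for c_(j+1), since
    only pairs of odd indices 2i + 1, 2(j - i) + 1 contribute to the square;
    in odd degree every pair has an even index and both terms vanish. *)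
Lemma catalan_coef_sqr m : (0 < m)%N ->
  h * (\sum_(i < m.+1) a i * a (m - i)%N) + a m.+1 = 0.
Proof.
move=> m_gt0; have [odd_m|even_m] := boolP (odd m).
  have -> : a m.+1 = 0 by rewrite /catalan_coef /= odd_m.
  rewrite addr0 big1 ?mulr0 // => -[i /= im] _.
  rewrite /catalan_coef; have [oi|] := boolP (odd i); last by rewrite mul0r.
  by rewrite oddB ?odd_m ?oi ?mulr0.
have [j ->] : exists j, m = j.+1.*2.
  by exists m./2.-1; have := even_halfK even_m; lia.
rewrite big_ord_recr /= subnn catalan_coef_even mul0r addr0.
rewrite (sum_even_odd (fun i => a i * a (j.+1.*2 - i)%N)) catalan_coef_odd.
rewrite catalanS natr_sum !mulr_suml mulr_sumr -big_split big1 //= => i _.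
have ij : (i <= j)%N by rewrite -ltnS.
have -> : (j.*2.+2 - i.*2.+1)%N = (j - i).*2.+1 by lia.
rewrite catalan_coef_even mul0r add0r !catalan_coef_odd natrM.
have -> : j.+2 = (i.+1 + (j - i).+1)%N by lia.
have -> : (- h) ^+ j.+1 = - h * ((- h) ^+ i * (- h) ^+ (j - i)).
  by rewrite -exprD subnKC // -exprS.
by rewrite exprD; ring.
Qed.

(** Multiplication by 2v = 1/t shifts the coefficients of u by one, so that
    the constant coefficient of the equation reads u_1 = r and those of
    positive degree are [catalan_coef_sqr]. *)
Lemma catalan_series_eq :
  let u := lseries a in
  forall k, h * lmul u u k + 2 * lmul u (half_inv_var R) k =
            lconst r k.
Proof.
move=> u k; rewrite lmul_lmonor mulrCA mulfV ?mulr1 ?pnatr_eq0 //.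
rewrite opprK lmul_lseries; case: k => [[|m]|[|m]] /=.
- rewrite big_ord1 (_ : a 0 = 0); last exact: (catalan_coef_even 0).
  have -> : a (0 + 1) = r by rewrite (catalan_coef_odd 0) mul1r expr1 mulr1.
  by rewrite mul0r mulr0 add0r.
- by rewrite addn1 catalan_coef_sqr.
- by rewrite mulr0 add0r; exact: (catalan_coef_even 0).
- by rewrite mulr0 add0r.
Qed.
End CatalanSeries.

(** * Partial sums of the Catalan generating function *)

Lemma triangular_sum (V : nmodType) (F : nat -> nat -> V) N :
  \sum_(n < N) \sum_(i < n.+1) F i (n - i)%N =
  \sum_(i < N) \sum_(j < N - i) F i j.
Proof.
elim: N => [|N IHN]; first by rewrite !big_ord0.
rewrite big_ord_recr {}IHN [RHS]big_ord_recr /= subSnn big_ord1.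
rewrite [X in _ + X]big_ord_recr /= subnn addrA -big_split.
by congr (_ + _); apply: eq_bigr => i _; rewrite subSn ?big_ord_recr // ltnW.
Qed.

Lemma ler_sum_widen (R : numDomainType) (f : nat -> R) m n :
  (forall i, 0 <= f i) -> (m <= n)%N -> \sum_(i < m) f i <= \sum_(i < n) f i.
Proof.
move=> f_ge0 mn; rewrite -(big_mkord xpredT) -[leRHS](big_mkord xpredT).
by rewrite (big_cat_nat _ mn) //= lerDl sumr_ge0.
Qed.

Definition catalan_sum (R : pzRingType) (z : R) (N : nat) : R :=
  \sum_(i < N) (catalan i)%:R * z ^+ i.

Section CatalanSum.
Variables (R : realType) (z : R).
Hypothesis z_ge0 : 0 <= z.
Local Notation catalan_sum := (catalan_sum z).

Let b i : R := (catalan i)%:R * z ^+ i.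

Let b_ge0 i : 0 <= b i.
Proof. by rewrite mulr_ge0 ?ler0n ?exprn_ge0. Qed.

Lemma catalan_sum_ge0 N : 0 <= catalan_sum N.
Proof. by apply: sumr_ge0 => i _; exact: b_ge0. Qed.

(** The truncation of C = 1 + z C^2, where the square is summed over the
    triangle i + j < N. *)
Lemma catalan_sumS N : catalan_sum N.+1 =
  1 + z * \sum_(i < N) \sum_(j < N - i) b i * b j.
Proof.
rewrite -(triangular_sum (fun i j => b i * b j)) /catalan_sum big_ord_recl /=.
rewrite expr0 mulr1 mulr_sumr.
congr (_ + _); apply: eq_bigr => n _; rewrite /bump /= add1n.
rewrite catalanS natr_sum mulr_suml mulr_sumr; apply: eq_bigr => i _.
have -> : z ^+ n.+1 = z * (z ^+ i * z ^+ (n - i)).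
  by rewrite -exprD subnKC -?exprS // -ltnS.
by rewrite /b natrM; ring.
Qed.

(** The triangle i + j < N lies in the square i, j < N. *)
Lemma catalan_sumS_le N : catalan_sum N.+1 <= 1 + z * catalan_sum N ^+ 2.
Proof.
rewrite catalan_sumS lerD2l ler_wpM2l // expr2 {1}/catalan_sum mulr_suml.
apply: ler_sum => i _; rewrite mulr_sumr.
apply: (ler_sum_widen (f := fun j => b i * b j)) => [j|]; last exact: leq_subr.
by rewrite mulr_ge0 ?b_ge0.
Qed.

(** The triangle i + j < 2N contains the square i, j < N. *)
Lemma catalan_sum_double_ge N :
  1 + z * catalan_sum N ^+ 2 <= catalan_sum N.*2.+1.
Proof.
rewrite catalan_sumS lerD2l ler_wpM2l // expr2 {1}/catalan_sum mulr_suml.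
apply: (@le_trans _ _ (\sum_(i < N) \sum_(j < N.*2 - i) b i * b j)).
  apply: ler_sum => i _; rewrite mulr_sumr.
  apply: (ler_sum_widen (f := fun j => b i * b j)) => [j|].
    by rewrite mulr_ge0 ?b_ge0.
  by have := ltn_ord i; lia.
apply: (ler_sum_widen (f := fun i => \sum_(j < N.*2 - i) b i * b j)); last lia.
by move=> i; apply: sumr_ge0 => j _; rewrite mulr_ge0 ?b_ge0.
Qed.

(** The bound 2 is preserved by s |-> 1 + z s^2 for all z <= 1/4; it is the
    double root of s = 1 + z s^2 at z = 1/4. *)
Lemma catalan_sum_le2 N : 4 * z <= 1 -> catalan_sum N <= 2.
Proof.
move=> z4; elim: N => [|N IHN]; first by rewrite /catalan_sum big_ord0.
apply: le_trans (catalan_sumS_le N) _.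
have := catalan_sum_ge0 N; nra.
Qed.
End CatalanSum.

(** Completing the square, 1 + z s^2 - s is at least 1 - 1/(4z), which is
    positive; so passing from S_N to S_(2N+1) gains at least this amount. *)
Lemma catalan_sum_unbounded (R : realType) (z B : R) :
  1 < 4 * z -> exists N, B < catalan_sum z N.
Proof.
move=> z4; have z_gt0 : 0 < z by lra.
have z_ge0 := ltW z_gt0.
pose d := 1 - (4 * z)^-1.
have d_gt0 : 0 < d by rewrite subr_gt0 invf_lt1 //; lra.
have step N : catalan_sum z N + d <= catalan_sum z N.*2.+1.
  apply: le_trans (catalan_sum_double_ge z_ge0 N).
  rewrite -subr_ge0 (_ : _ - _ = z * (catalan_sum z N - (2 * z)^-1) ^+ 2).
    by rewrite mulr_ge0 ?sqr_ge0.
  rewrite /d; field; lra.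
have grow k : exists N, k%:R * d <= catalan_sum z N.
  elim: k => [|k [N IHk]].
    by exists 0%N; rewrite mul0r (catalan_sum_ge0 z_ge0).
  exists N.*2.+1; apply: le_trans (step N).
  by rewrite mulrSr mulrDl mul1r lerD2r.
have [N leN] := grow (Num.bound `|B / d|); exists N; apply: lt_le_trans leN.
rewrite -ltr_pdivrMr //; apply: le_lt_trans (ler_norm _) _.
exact: archi_boundP (normr_ge0 _).
Qed.

(** * Radius of convergence *)

Section Radius.
Variables (R : realType) (r h : R).
Local Notation a := (catalan_coef r h).

Lemma norm_catalan_series (y : R) N :
  \sum_(k < N.*2) `|a k * y ^+ k| =
  `|r * y| * catalan_sum (`|r * h| * y ^+ 2) N.
Proof.
rewrite (sum_even_odd (fun k => `|a k * y ^+ k|)) mulr_sumr.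
apply: eq_bigr => i _.
rewrite catalan_coef_even mul0r normr0 add0r catalan_coef_odd.
rewrite -muln2 mulnC !normrM !normrX !normrN normr_nat exprMn exprMn.
rewrite -exprM -[y ^+ (2 * i)](ger0_norm (exprn_even_ge0 _ _)) ?oddM //.
by rewrite normrX !exprS; ring.
Qed.

Lemma cvg_catalan_series (y : R) :
  4 * (`|r * h| * y ^+ 2) <= 1 -> cvgn (pseries a y).
Proof.
move=> y4; apply: normed_cvg; apply: nondecreasing_is_cvgn.
  by apply: nondecreasing_series => n _ _; exact: normr_ge0.
exists (`|r * y| * 2) => _ [N _ <-].
rewrite /= /series /= big_mkord.
apply: (@le_trans _ _ (\sum_(k < N.*2) `|a k * y ^+ k|)).
  by apply: (ler_sum_widen (f := fun k => `|a k * y ^+ k|)) => //; lia.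
rewrite norm_catalan_series ler_wpM2l // catalan_sum_le2 //.
by rewrite mulr_ge0 ?sqr_ge0.
Qed.

(** Convergence at x yields absolute convergence at every smaller y > 0,
    hence bounded Catalan sums at z = |r h| y^2; if 4 |r h| x^2 > 1 then y can
    be chosen close enough to |x| for z to exceed 1/4. *)
Lemma cvg_catalan_series_le (x : R) : r != 0 ->
  cvgn (pseries a x) -> 4 * (`|r * h| * x ^+ 2) <= 1.
Proof.
move=> r0 cvgx; rewrite leNgt; apply/negP => x4.
set c := `|r * h| in x4 *.
have [y [y_gt0 yx y4]] : exists y, [/\ 0 < y, y < `|x| & 1 < 4 * (c * y ^+ 2)].
  have x_gt0 : 0 < `|x| by rewrite normr_gt0; apply: contraTneq x4 => ->; lra.
  pose q := 4 * (c * x ^+ 2); have q_gt1 : 1 < q by [].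
  have qV : q^-1 < 1 by rewrite invf_lt1 //; lra.
  have qV_gt0 : 0 < q^-1 by rewrite invr_gt0; lra.
  (* With this y, 4 |r h| y^2 = (q + 1)^2 / (4 q) > 1 by AM-GM. *)
  exists (`|x| * ((1 + q^-1) / 2)); split.
  - by rewrite mulr_gt0 //; lra.
  - by rewrite -[ltRHS]mulr1 ltr_pM2l //; lra.
  - have -> : 4 * (c * (`|x| * ((1 + q^-1) / 2)) ^+ 2) =
              1 + (q - 1) ^+ 2 / (4 * q).
      rewrite exprMn real_normK ?num_real //.
      have -> : 4 * (c * (x ^+ 2 * ((1 + q^-1) / 2) ^+ 2)) =
                q * ((1 + q^-1) / 2) ^+ 2 by rewrite /q; ring.
      by field; lra.
    by rewrite ltrDl divr_gt0 ?exprn_gt0 //; lra.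
have := is_cvg_pseries_inside_norm cvgx (_ : `|y| < `|x|).
rewrite gtr0_norm // => /(_ yx) cvgy.
have ry : 0 < `|r * y| by rewrite normr_gt0 mulf_neq0 // gt_eqF.
have [N] := catalan_sum_unbounded
  (limn (pseries (fun k => `|a k|) y) / `|r * y|) y4.
rewrite ltr_pdivrMr // mulrC -norm_catalan_series ltNge => /negP; apply.
have -> : \sum_(k < N.*2) `|a k * y ^+ k| = pseries (fun k => `|a k|) y N.*2.
  rewrite /pseries /series /= big_mkord; apply: eq_bigr => k _.
  by rewrite normrM normrX (gtr0_norm y_gt0).
apply: nondecreasing_cvgn_le => //.
apply: nondecreasing_series => k _ _.
by rewrite mulr_ge0 ?exprn_ge0 // ltW.
Qed.

Lemma catalan_radius : r != 0 -> h != 0 ->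
  convergence_radius a = ((2 * Num.sqrt `|r * h|)^-1)%:E.
Proof.
move=> r_neq0 h_neq0; set rho := (_^-1).
have c_gt0 : 0 < `|r * h| by rewrite normr_gt0 mulf_neq0.
have rho_gt0 : 0 < rho by rewrite invr_gt0 mulr_gt0 ?sqrtr_gt0.
have rho2 : 4 * (`|r * h| * rho ^+ 2) = 1.
  rewrite exprVn exprMn sqr_sqrtr ?ltW //; field; lra.
apply/eqP; rewrite eq_le; apply/andP; split.
  apply: ge_ereal_sup => _ [x /= cvgx <-]; rewrite lee_fin.
  rewrite -ler_sqr ?nnegrE ?(ltW rho_gt0) // real_normK ?num_real //.
  by rewrite -(ler_pM2l c_gt0); have := cvg_catalan_series_le r_neq0 cvgx; lra.
apply: ereal_sup_ubound; exists rho => /=; last by rewrite gtr0_norm.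
by apply: cvg_catalan_series; rewrite rho2.
Qed.
End Radius.

(** * The square of omega *)

Theorem proposition4p1 (R : realType) (C : chow_theory R) (n : nat)
    (X Y : variety C) (p : vmor X Y) (s : vmor Y X) (H : chow Y) (h : R)
    (dimX : vdim X = n) (flat_p : flat p 1) (sec_s : is_section p s)
    (divH : chow_gr 1 H)
    (Theta2 : section_class s ^+ 2 = h *: (section_class s * pull p H))
    (r : R) (r_neq0 : r != 0) :
  (let Theta : chow X := section_class s in
   let u : laurent R := lseries (catalan_coef r h) in
   let v : laurent R := half_inv_var R in
   let omega : laurent (chow X) := ladd (lscale u Theta) (lscale v (pull p H)) in
   forall eta : chow Y, chow_gr (n%:Z - 2) eta ->
     lmul (lmul omega omega) (lconst (pull p eta))
     = lconst (r *: (Theta * pull p H * pull p eta)))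
  /\
  (h != 0 ->
   convergence_radius (catalan_coef r h) = ((2 * Num.sqrt `|r * h|)^-1)%:E).
Proof.
split; last exact: catalan_radius.
move=> Theta u v omega eta eta_deg.
have dimY : n = (vdim Y + 1)%N by rewrite -dimX (flat_dim flat_p).
have H2eta : H ^+ 2 * eta = 0.
  apply: (@chow_gr_out _ _ (chow Y) n%:Z); first lia.
  rewrite (_ : n%:Z = 1 + 1 + (n%:Z - 2)); last lia.
  by apply: chow_grM => //; apply: chow_grM.
apply: laurentP => k; rewrite /lconst lmul_lmonor subr0.
rewrite lmulDl !lmulDr !lmul_lscale.
have vu : lmul v u k = lmul u v k by rewrite lmul_lmonol lmul_lmonor mulrC.
have pH2eta : pull p H * pull p H * pull p eta = 0.
  by rewrite -!rmorphM -expr2 H2eta rmorph0.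
have -> : lmono 0 (r *: (Theta * pull p H * pull p eta)) k =
          lconst r k *: (Theta * pull p H * pull p eta).
  by rewrite /lconst /=; case: eqP => // _; rewrite scale0r.
rewrite -(catalan_series_eq r h) -/u -/v.
set T := Theta * pull p H; set Q := pull p H * pull p H.
transitivity ((lmul u u k *: (Theta * Theta) + lmul u v k *: T +
  (lmul v u k *: (pull p H * Theta) + lmul v v k *: Q)) * pull p eta).
  by [].
rewrite vu (mulrC (pull p H)) -/T -expr2 Theta2 -/T !mulrDl -!scalerAl pH2eta.
rewrite scaler0 addr0 scalerA -!scalerDl.
by congr (_ *: _); rewrite scalerDl scale1r mulrC addrA.
Qed.
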